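(* Let $\mathcal{M}$ be a gOLF model and let $\mathcal{M}'=\mathcal{M}^n(\Gamma(\mathcal{M}))$ be the non-oblivious influence model of the influence game $\Gamma(\mathcal{M})$ associated with $\mathcal{M}$. Then the collective decision functions of $\mathcal{M}$ and $\mathcal{M}'$ coincide, i.e. $C_{\mathcal{M}}(x)=C_{\mathcal{M}'}(x)$ for every initial decision vector $x\in\{0,1\}^n$.
   Context: Graphs are finite, directed, without loops or multiple edges; $P(i)=P_G(i)=\{j\mid (j,i)\in E\}$, $S_G(i)=\{j\mid(i,j)\in E\}$, $\delta^-(i)=|P_G(i)|$. For $x\in\{0,1\}^n$, $X(x)=\{i\mid x_i=1\}$. A gOLF is a triple $\mathcal{M}=(G,r,q)$ where $G=(V,E)$ is a two layered bipartite digraph ($V=V_1\cup V_2$ disjoint, $E\subseteq V_1\times V_2$), $n=|V|$, $r$ is a rational with $1/2\le r\le 1$, $q$ is a natural number with $0<q\le n$. For $x\in\{0,1\}^n$ and $i\in V$, put $p=|\{j\in P_G(i)\mid x_j=1\}|$, $\bar p=|\{j\in P_G(i)\mid x_j=0\}|$, $t=\lceil r|P_G(i)|\rceil$; then $c_i=1$ if $p\ge t$ and $\bar p<t$; $c_i=0$ if $\bar p\ge t$ and $p<t$; $c_i=x_i$ otherwise. $C_{\mathcal{M}}(x)=1$ if $|\{i\in V\mid c_i=1\}|\ge q$, else $0$. Let $\mathtt{L}=\{i\mid P_G(i)=\emptyset,S_G(i)\ne\emptyset\}$, $\mathtt{F}=\{i\mid S_G(i)=\emptyset,P_G(i)\ne\emptyset\}$,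 $\mathtt{I}=\{i\mid S_G(i)=P_G(i)=\emptyset\}$. The associated influence game is $\Gamma(\mathcal{M})=(G,f,q,N)$ with $N=\mathtt{L}\cup\mathtt{I}$, $f(i)=\lceil r\,\delta^-(i)\rceil$ for $i\in\mathtt{F}$ and $f(i)=1$ for $i\in\mathtt{L}\cup\mathtt{I}$. For an influence game $\Gamma=(G,f,q,N)$ ($G=(V,E)$ a digraph, $f$ a labeling of vertices by positive rationals, $q$ an integer with $0\le q\le n$, $N\subseteq V$) and $X\subseteq V$: $F^0(X)=X$, $F^t(X)=F^{t-1}(X)\cup\{i\in V\mid |P_G(i)\cap F^{t-1}(X)|\ge f(i)\}$ for $1\le t\le n$, $F(X)=F^n(X)$. The non-oblivious influence model $\mathcal{M}^n(\Gamma)$: let $p_i(x)=|F(X(x)\cap N)\cap P(i)|$, $q_i(x)=|P(i)\setminus F(X(x)\cap N)|$. For $i\in V\setminus N$: $c_i=1$ if $p_i(x)\ge f(i)$ and $q_i(x)<f(i)$; $c_i=0$ if $q_i(x)\ge f(i)$ and $p_i(x)<f(i)$; $c_i=x_i$ otherwise. For $i\in N$: $c_i=1$ if $i\in F(X(x))$, else $c_i=0$. Its collective decision function is $C(x)=1$ if $|\{i\in V\mid c_i=1\}|\ge q$, else $0$. *)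

(* Defs.v *)
From mathcomp Require Import all_boot all_order all_algebra.
Set Implicit Arguments.
Unset Strict Implicit.
Unset Printing Implicit Defensive.
Import Order.TTheory GRing.Theory Num.Theory.
Local Open Scope ring_scope.

Record digraph := Digraph {
  vertex :> finType;
  edge : rel vertex;
  edge_irrefl : irreflexive edge
}.

Section Digraph.
Variable G : digraph.

Definition predecessors (i : G) : {set G} := [set j | edge j i].
Definition successors (i : G) : {set G} := [set j | edge i j].
Definition indegree (i : G) : nat := #|predecessors i|.

Definition leaders : {set G} :=
  [set i | (predecessors i == set0) && (successors i != set0)].
Definition followers : {set G} :=
  [set i | (successors i == set0) && (predecessors i != set0)].
Definition independents : {set G} :=
  [set i | (successors i == set0) && (predecessors i == set0)].

(* An element of {0,1}^n is a boolean function on the vertices, with true for 1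
   and false for 0. *)
Definition decisions := {ffun G -> bool}.

Definition ones (x : decisions) : {set G} := [set i | x i].

End Digraph.

Record gOLF := GOLF {
  golf_graph : digraph;
  golf_V1 : {set golf_graph};
  golf_V2 : {set golf_graph};
  golf_disjoint : [disjoint golf_V1 & golf_V2];
  golf_cover : golf_V1 :|: golf_V2 = [set: golf_graph];
  golf_layered : forall i j : golf_graph,
    edge i j -> (i \in golf_V1) && (j \in golf_V2);
  golf_r : rat;
  golf_r_bounds : 1 / 2%:R <= golf_r <= 1;
  golf_q : nat;
  golf_q_bounds : (0 < golf_q <= #|golf_graph|)%N
}.

Section GOLFDecision.
Variables (M : gOLF) (x : decisions (golf_graph M)).

Definition golf_threshold (i : golf_graph M) : int :=
  Num.ceil (golf_r M * (indegree i)%:R).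

Definition golf_choice (i : golf_graph M) : bool :=
  let p := #|[set j in predecessors i | x j]|%:Z in
  let p' := #|[set j in predecessors i | ~~ x j]|%:Z in
  let t := golf_threshold i in
  if (t <= p) && (p' < t) then true
  else if (t <= p') && (p < t) then false
  else x i.

Definition golf_decision : bool :=
  (golf_q M <= #|[set i | golf_choice i]|)%N.

End GOLFDecision.

Record influence_game := InfluenceGame {
  game_graph : digraph;
  game_label : game_graph -> rat;
  game_label_gt0 : forall i, 0 < game_label i;
  game_q : nat;
  game_q_le : (game_q <= #|game_graph|)%N;
  game_N : {set game_graph}
}.

Section NonObliviousModel.
Variable Gamma : influence_game.
Notation V := (game_graph Gamma).

Definition spread_step (X : {set V}) : {set V} :=
  X :|: [set i | game_label i <= #|predecessors i :&: X|%:R].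

Definition spread (X : {set V}) : {set V} := iter #|V| spread_step X.

Variable x : decisions V.

Definition nonoblivious_choice (i : V) : bool :=
  if i \in game_N Gamma then i \in spread (ones x)
  else
    let Y := spread (ones x :&: game_N Gamma) in
    let p : rat := #|Y :&: predecessors i|%:R in
    let p' : rat := #|predecessors i :\: Y|%:R in
    let t := game_label i in
    if (t <= p) && (p' < t) then true
    else if (t <= p') && (p < t) then false
    else x i.

Definition nonoblivious_decision : bool :=
  (game_q Gamma <= #|[set i | nonoblivious_choice i]|)%N.

End NonObliviousModel.

Section AssociatedGame.
Variable M : gOLF.
Notation V := (golf_graph M).

(* A gOLF graph is two-layered, so a vertex outside followers is a leader or
   independent. *)
Definition golf_label (i : V) : rat :=
  if i \in followers V then (golf_threshold i)%:~R else 1.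

Lemma golf_label_gt0 (i : V) : 0 < golf_label i.
Proof.
rewrite /golf_label; case: ifP => // iF; rewrite ltr0z.
move: iF; rewrite inE => /andP[_ Pi].
have r_gt0 : 0 < golf_r M.
  by have /andP[+ _] := golf_r_bounds M; apply: lt_le_trans.
by rewrite /golf_threshold ceil_gt_int mulr_gt0 // ltr0n card_gt0.
Qed.

Lemma golf_q_le : (golf_q M <= #|V|)%N.
Proof. by have /andP[] := golf_q_bounds M. Qed.

Definition associated_game : influence_game :=
  @InfluenceGame V golf_label golf_label_gt0 (golf_q M) golf_q_le
    (leaders V :|: independents V).

End AssociatedGame.

(* Main.v *)
(** Edges go from [V1] to [V2], so no vertex has both a predecessor and a
    successor. Spreading never activates a vertex without predecessors, hence on
    those vertices it leaves the initial decision unchanged. Every predecessor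
    of a follower is such a vertex, so a follower counts the same votes in both
    models, against the same threshold. *)
Require Import Defs.
From mathcomp Require Import all_boot all_order all_algebra.
Import Order.TTheory GRing.Theory Num.Theory.

Lemma mem_leaders_independents (G : digraph) (i : G) :
  (i \in leaders G :|: independents G) = (predecessors i == set0).
Proof. by rewrite !inE; case: (successors i == set0); rewrite ?andbF ?andbT ?orbF. Qed.

(** Labels are positive, so an empty set of predecessors never reaches the threshold at any step. *)
Lemma mem_spread_source (Gamma : influence_game) (X : {set game_graph Gamma})
    (i : game_graph Gamma) :
  predecessors i = set0 -> (i \in spread X) = (i \in X).
Proof.
move=> Pi0; rewrite /spread; elim: #|_| => //= n IHn.
by rewrite !inE Pi0 set0I cards0 leNgt game_label_gt0 orbF.
Qed.

Section GOLF.
Variable M : gOLF.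
Notation V := (golf_graph M).

Lemma golf_edge_target (i j : V) : edge i j -> successors j = set0.
Proof.
move=> /golf_layered /andP[_ jV2]; apply/setP=> k; rewrite !inE.
apply/negP=> /golf_layered /andP[jV1 _].
by rewrite (disjointFl (golf_disjoint M) jV2) in jV1.
Qed.

Lemma golf_edge_source (i j : V) : edge i j -> predecessors i = set0.
Proof.
move=> ij; apply/setP=> k; rewrite !inE; apply/negP=> /golf_edge_target /setP/(_ j).
by rewrite !inE ij.
Qed.

Lemma golf_followerE (i : V) : (i \in followers V) = (predecessors i != set0).
Proof.
rewrite inE andb_idl // => /set0Pn[j]; rewrite inE.
by move=> /golf_edge_target ->.
Qed.

Lemma golf_choiceE (x : decisions V) (i : V) :
  golf_choice x i = @nonoblivious_choice (associated_game M) x i.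
Proof.
rewrite /golf_choice /nonoblivious_choice /= mem_leaders_independents.
case: eqP => [Pi0|/eqP Pi].
  have no_vote (P : pred V) : [set j in predecessors i | P j] = set0.
    by apply/setP=> j; rewrite Pi0 !inE.
  rewrite (@mem_spread_source (associated_game M)) // inE !no_vote cards0.
  (* Both counts are 0, and [t <= 0] excludes [0 < t]: both tests fail whatever the threshold, which
     leaves [x i]. *)
  by case: (lerP (golf_threshold i) (Posz 0)).
rewrite /golf_label golf_followerE Pi.
set Y := spread _.
(* The predecessors of [i] all lie in [game_N], so intersecting with it discards none of their
   votes. *)
have inY j : edge j i -> (j \in Y) = x j.
  move=> /golf_edge_source Pj0.
  rewrite (@mem_spread_source (associated_game M)) // inE /=.
  by rewrite mem_leaders_independents Pj0 eqxx andbT inE.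
have -> : Y :&: predecessors i = [set j in predecessors i | x j].
  by apply/setP=> j; rewrite !inE andbC; apply: andb_id2l => /inY.
have -> : predecessors i :\: Y = [set j in predecessors i | ~~ x j].
  by apply/setP=> j; rewrite !inE andbC; apply: andb_id2l => /inY ->.
(* One model compares integers, the other their images in [rat]; the embedding preserves and
   reflects order. *)
by rewrite !pmulrn !ler_int !ltr_int.
Qed.

End GOLF.

Theorem lemma3 (M : gOLF) (x : decisions (golf_graph M)) :
  golf_decision x = @nonoblivious_decision (associated_game M) x.
Proof.
rewrite /golf_decision /nonoblivious_decision /=.
by congr (_ <= _)%N; apply: eq_card => i; rewrite !inE golf_choiceE.
Qed.
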